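(* Let $\mathcal{E}$ be a collection of spaces. If $f:X\to Y$ and $g:Y\to Z$ are maps, then $$\mathcal{E}\text{-}\mathrm{secat}(gf)\le\mathrm{cat}_{\mathrm{FH}}(g)+\mathcal{E}\text{-}\mathrm{secat}(f).$$
   Context: All spaces are assumed to have the homotopy type of connected CW-complexes; spaces have no base points and maps are not required to preserve base points. A collection $\mathcal{E}$ of spaces means any collection of spaces containing the one-point space $*$. Given $f:X\to Y$, a subset $U\subseteq Y$ with inclusion $i:U\hookrightarrow Y$ is $\mathcal{E}$-section-categorical (with respect to $f$) if there are a space $E\in\mathcal{E}$ and maps $u:U\to E$, $v:E\to X$ with $fvu\simeq i$. The (reduced) $\mathcal{E}$-sectional category $\mathcal{E}\text{-}\mathrm{secat}(f)$ is the smallest integer $n\ge 0$ such that $Y$ has an open cover by $n+1$ subsets each of which is $\mathcal{E}$-section-categorical with respect to $f$ (and $\infty$ if no such $n$ exists). The (reduced) Fadell-Husseini category $\mathrm{cat}_{\mathrm{FH}}(f)$ of a map $f:X\to Y$ is defined as follows. Replacing $Y$ by the mapping cylinder $M_f$ of $f$, regard $f$ as an inclusion $X\subseteq Y$. Then $\mathrm{cat}_{\mathrm{FH}}(f)$ is the smallest $n\ge0$ such that there is an open cover $\{U_0,U_1,\dots,U_n\}$ of $Y$ with inclusions $j_i:U_i\to Y$ such that: (1) $j_i$ is homotopic to a constant map for $i=1,\dots,n$; (2) $X\subseteq U_0$; (3) there is a map $r:U_0\to X$ and a homotopy of pairs $j_0\simeq r:(U_0,X)\to(Y,X)$. It is $\infty$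 if no such $n$ exists. *)

(* Defs.v *)
From HB Require Import structures.
From mathcomp Require Import all_boot all_order all_algebra generic_quotient.
From mathcomp Require Import all_classical all_reals topology normedtype.
Set Implicit Arguments.
Unset Strict Implicit.
Unset Printing Implicit Defensive.
Import Order.TTheory GRing.Theory Num.Theory.
Import numFieldNormedType.Exports.

Local Open Scope classical_set_scope.
Local Open Scope ring_scope.
Local Open Scope quotient_scope.

(* Subsets, when used as types, carry the topology induced by [set_val]; in
   particular a map out of a subset [U] is a continuous function on [U] alone. *)

(** * Homotopies *)

Section Interval.
Variable R : realType.

Definition unit_itv : set R := `[0, 1].
Definition itvI : topologicalType := set_type unit_itv.

Definition mkI (t : R) (h : 0 <= t <= 1) : itvI :=
  exist _ t (mem_set (h : unit_itv t)).

Definition I0 : itvI := mkI (introT andP (conj (lexx 0) ler01)).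
Definition I1 : itvI := mkI (introT andP (conj ler01 (lexx 1))).

End Interval.

Section Homotopy.
Variable R : realType.

Definition homotopy_from_to (A B : topologicalType) (h k : A -> B)
    (H : A * itvI R -> B) : Prop :=
  [/\ continuous H, forall a, H (a, I0 R) = h a & forall a, H (a, I1 R) = k a].

Definition homotopic (A B : topologicalType) (h k : A -> B) : Prop :=
  exists H, homotopy_from_to h k H.

Definition homotopy_equivalent (A B : topologicalType) : Prop :=
  exists (h : A -> B) (k : B -> A),
    [/\ continuous h, continuous k,
        homotopic (k \o h) idfun & homotopic (h \o k) idfun].

End Homotopy.

(** * CW-complexes *)

Section CW.
Variable R : realType.

(* The norm on ['rV[R]_n] is the sup norm, so the Euclidean one is spelled
   out. *)
Definition sqnorm n (x : 'rV[R]_n) : R := \sum_(i < n) x ord0 i ^+ 2.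

Definition disk n : topologicalType :=
  set_type [set x : 'rV[R]_n | sqnorm x <= 1].

Definition disk_int n : set (disk n) := [set x | sqnorm (set_val x) < 1].
Definition disk_bnd n : set (disk n) := [set x | sqnorm (set_val x) = 1].

(* For a continuous [phi] and an open [A], this says that [phi] restricts to a
   homeomorphism from [A] onto [phi @` A]. *)
Definition inj_open_onto_image (D W : topologicalType) (phi : D -> W)
    (A : set D) : Prop :=
  (forall x y, A x -> A y -> phi x = phi y -> x = y) /\
  (forall O : set D, open O -> O `<=` A ->
     exists2 V : set W, open V & phi @` O = V `&` phi @` A).

(* [J] indexes the cells, [phi j] is the characteristic map of the cell [j], of
   dimension [d j]. *)
Definition cw_structure (W : topologicalType) (J : Type) (d : J -> nat)
    (phi : forall j, disk (d j) -> W) : Prop :=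
  let cell j := phi j @` @disk_int (d j) in
  [/\ forall j, continuous (phi j),
      forall j, inj_open_onto_image (phi j) (@disk_int (d j)),
      (forall w, exists j, cell j w) /\
        (forall j k w, cell j w -> cell k w -> j = k),
      (* closure-finiteness *)
      forall j, exists2 F : set J, finite_set F &
        (forall k, F k -> (d k < d j)%N) /\
        phi j @` @disk_bnd (d j) `<=` \bigcup_(k in F) cell k
    & (* weak topology *)
      forall C : set W, (forall j, closed (phi j @^-1` C)) -> closed C].

Definition is_CW_complex (W : topologicalType) : Prop :=
  hausdorff_space W /\
  exists (J : Type) (d : J -> nat) (phi : forall j, disk (d j) -> W),
    cw_structure phi.

(* The library's [connected] holds of the empty set; a connected space is
   nonempty. *)
Definition has_connected_CW_type (X : topologicalType) : Prop :=
  exists W : topologicalType,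
    [/\ is_CW_complex W, [set: W] !=set0, connected [set: W]
      & homotopy_equivalent R X W].

End CW.

(** * Numerical invariants *)

Definition open_cover (Y : topologicalType) n (U : 'I_n -> set Y) : Prop :=
  (forall i, open (U i)) /\ \bigcup_i U i = [set: Y].

(* The smallest [n] such that [P n], or [+oo] if there is none. *)
Definition least_or_infty (P : nat -> Prop) : \bar int :=
  if pselect (exists n, `[< P n >]) is left exP
  then (Posz (ex_minn exP))%:E else +oo%E.

(** * E-sectional category *)

Definition is_collection (R : realType) (E : topologicalType -> Prop) : Prop :=
  (forall T, E T -> has_connected_CW_type R T) /\
  (exists2 T, E T & exists p : T, forall q, q = p).

Section Secat.
Variables (R : realType) (E : topologicalType -> Prop).

Definition section_categorical (X Y : topologicalType) (f : X -> Y)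
    (U : set Y) : Prop :=
  exists (T : topologicalType) (u : U -> T) (v : T -> X),
    [/\ E T, continuous u, continuous v
      & homotopic R (f \o v \o u) (set_val : U -> Y)].

Definition secat (X Y : topologicalType) (f : X -> Y) : \bar int :=
  least_or_infty (fun n => exists U : 'I_n.+1 -> set Y,
    open_cover U /\ forall i, section_categorical f (U i)).

End Secat.

(** * Mapping cylinder *)

Section MappingCylinder.
Variables (R : realType) (X Y : topologicalType) (f : X -> Y).

(* [{b : bool & cyl_piece b}] is the topological sum of [X * I] and [Y]. *)
Definition cyl_piece (b : bool) : topologicalType :=
  if b then (X * itvI R)%type : topologicalType else Y.

Definition cyl_sum : topologicalType := {b : bool & cyl_piece b}.

Definition cyl_top (p : X * itvI R) : cyl_sum := existT cyl_piece true p.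
Definition cyl_bot (y : Y) : cyl_sum := existT cyl_piece false y.

(* Replaces [(x, 1)] by [f x] and fixes every other point, so that having equal
   images under [cyl_glue] is the equivalence relation generated by
   [(x, 1) ~ f x]. *)
Definition cyl_glue (p : cyl_sum) : cyl_sum :=
  match p with
  | existT true xt => if xt.2 == I1 R then cyl_bot (f xt.1) else cyl_top xt
  | existT false y => cyl_bot y
  end.

Definition cyl_rel' (p q : cyl_sum) : bool := cyl_glue p == cyl_glue q.

Lemma cyl_rel_refl : reflexive cyl_rel'.
Proof. by move=> p; rewrite /cyl_rel'. Qed.

Lemma cyl_rel_sym : symmetric cyl_rel'.
Proof. by move=> p q; rewrite /cyl_rel' eq_sym. Qed.

Lemma cyl_rel_trans : transitive cyl_rel'.
Proof. by move=> p q r; rewrite /cyl_rel' => /eqP -> /eqP ->. Qed.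

Definition cyl_rel := EquivRel _ cyl_rel_refl cyl_rel_sym cyl_rel_trans.

Definition mapping_cylinder := {eq_quot cyl_rel}.

HB.instance Definition _ :=
  Topological.copy mapping_cylinder (quotient_topology mapping_cylinder).
HB.instance Definition _ := Quotient.on mapping_cylinder.

Definition cyl_incl (x : X) : mapping_cylinder :=
  \pi_mapping_cylinder (cyl_top (x, I0 R)).

End MappingCylinder.

(** * Fadell-Husseini category *)

Section FadellHusseini.
Variable R : realType.

(* [inc : X -> M] plays the role of the inclusion of [X] in [M]. *)
Definition FH_cover (X M : topologicalType) (inc : X -> M) n
    (U : 'I_n.+1 -> set M) : Prop :=
  [/\ open_cover U,
      forall i, i != ord0 ->
        exists m : M, homotopic R (set_val : U i -> M) (cst m),
      range inc `<=` U ord0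
    & exists (r : U ord0 -> X) (H : U ord0 * itvI R -> M),
        [/\ continuous r,
            homotopy_from_to (set_val : U ord0 -> M) (inc \o r) H
          & forall p t, range inc (set_val p) -> range inc (H (p, t))]].

Definition catFH (X Y : topologicalType) (f : X -> Y) : \bar int :=
  least_or_infty (fun n =>
    exists U : 'I_n.+1 -> set (mapping_cylinder R f),
      FH_cover (@cyl_incl R X Y f) U).

End FadellHusseini.

(* Main.v *)
Require Import Defs.
From mathcomp Require Import all_boot all_order all_algebra.
From mathcomp Require Import all_classical all_reals topology normedtype.
From mathcomp Require Import generic_quotient.
From mathcomp Require Import lra.

(** Let [n] and [m] be the two invariants on the right, both finite, realized by
    open covers [U_0, .., U_n] of the mapping cylinder [M] of [g] and
    [V_0, .., V_m] of [Y]. On [U_0] there is [r : U_0 -> Y] such that the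
    inclusion into [M] is homotopic to [r] followed by [Y -> M]. Hence, on
    [r^-1 (V_j)], the inclusion deforms into [Y] with image in [V_j], where it
    factors through a space of the collection up to homotopy. The [m + 1] sets
    [r^-1 (V_j)] cover [U_0], so that together with [U_1, .., U_n] they form a
    cover of [M] by [n + m + 1] open sets.

    Since [Z] sits in [M] as the base and [M] retracts onto it by a map that
    equals [g] on [Y], intersecting these sets with [Z] and pushing the
    homotopies down to [Z] gives a cover of [Z]
    ([FH_cover_secat_cover]). The parts of [r^-1 (V_j)] are section-categorical
    with respect to [g \o f] by [section_categorical_lift]. The part of [U_i]
    with [0 < i] is null-homotopic in [Z]; its contraction can be
    prolonged to a point in the image of [g \o f], which makes it factor
    through the one-point space of the collection
    ([section_categorical_null]).

    The last step moves a point of [Z] to another one, so it requires [Z] to be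
    path-connected, whereas the hypothesis is that [Z] has the homotopy type of
    a connected CW-complex. In a CW-complex each closed cell lies in a single
    path component, so the weak topology makes every union of path components
    closed; hence path components are clopen
    ([connected_CW_path_connected]). Path-connectedness is then transported
    along homotopy equivalences. *)

Set Implicit Arguments.
Unset Strict Implicit.
Unset Printing Implicit Defensive.
Import Order.TTheory GRing.Theory Num.Theory.
Import numFieldNormedType.Exports.

Local Open Scope classical_set_scope.
Local Open Scope ring_scope.
Local Open Scope quotient_scope.

(** * Subspaces *)

Lemma continuous_into_subset (A B : topologicalType) (U : set B) (h : A -> U) :
  continuous (set_val \o h) -> continuous h.
Proof. exact: continuous_comp_initial. Qed.

Lemma continuous_set_val (B : topologicalType) (U : set B) :
  continuous (set_val : U -> B).
Proof. exact: initial_continuous. Qed.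

Definition corestrict (A B : topologicalType) (U : set B) (h : A -> B)
    (hU : forall a, U (h a)) : A -> U :=
  fun a => exist _ (h a) (mem_set (hU a)).

Lemma continuous_corestrict (A B : topologicalType) (U : set B) (h : A -> B)
    (hU : forall a, U (h a)) :
  continuous h -> continuous (corestrict hU).
Proof. by move=> ch; apply: continuous_into_subset. Qed.

Lemma continuous_compose (A B C : topologicalType) (h : A -> B) (k : B -> C) :
  continuous h -> continuous k -> continuous (k \o h).
Proof. by move=> ch ck x; apply: continuous_comp; [exact: ch|exact: ck]. Qed.

Lemma continuous_pairing (A B C : topologicalType) (h : A -> B) (k : A -> C) :
  continuous h -> continuous k -> continuous (fun x => (h x, k x)).
Proof. by move=> ch ck x; apply: cvg_pair; [exact: ch|exact: ck]. Qed.

Lemma continuous_comp_pair (A B C D : topologicalType) (F : B * C -> D)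
    (h : A -> B) (k : A -> C) :
  continuous F -> continuous h -> continuous k ->
  continuous (fun x => F (h x, k x)).
Proof.
by move=> cF ch ck; exact: continuous_compose (continuous_pairing ch ck) cF.
Qed.

Lemma continuous_fst (A B : topologicalType) : continuous (@fst A B).
Proof. by move=> p; exact: cvg_fst. Qed.

Lemma continuous_snd (A B : topologicalType) : continuous (@snd A B).
Proof. by move=> p; exact: cvg_snd. Qed.

(** The domain of a map defined on an open subset is a type of its own; this
    turns its open subsets back into open subsets of the ambient space. *)
Lemma open_image_set_val (B : topologicalType) (U : set B) (A : set U) :
  open U -> open A -> open (set_val @` A).
Proof.
move=> oU [O oO <-]; suff -> : (set_val : U -> B) @` (set_val @^-1` O) = U `&` O.
  exact: (openI oU oO).
apply/seteqP; split=> [_ [x Ox <-]|x [Ux Ox]].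
  by split=> //; exact: set_valP.
by exists (exist _ x (mem_set Ux)).
Qed.

(** * Homotopies *)

Section HomotopyTheory.
Variable R : realType.

(** Retracting the line onto the interval lets reparametrizations of a homotopy
    be written as real expressions in the time parameter, with no proof that
    they stay within bounds. *)
Lemma clamp_subproof (x : R) : 0 <= Num.max 0 (Num.min 1 x) <= 1.
Proof. by rewrite le_max lexx /= ge_max ler01 ge_min lexx. Qed.

Definition clamp (x : R) : itvI R := mkI (clamp_subproof x).

Lemma set_val_itv (t : itvI R) : 0 <= (set_val t : R) <= 1.
Proof. by have := set_valP t; rewrite /unit_itv /= in_itv. Qed.

Lemma clamp_le0 (x : R) : x <= 0 -> clamp x = I0 R.
Proof.
move=> x0; apply: val_inj => /=.
by apply/max_idPl; rewrite ge_min x0 orbT.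
Qed.

Lemma clamp_ge1 (x : R) : 1 <= x -> clamp x = I1 R.
Proof.
by move=> x1; apply: val_inj => /=; rewrite (min_idPl x1); apply/max_idPr.
Qed.

Lemma continuous_clamp : continuous clamp.
Proof.
apply: continuous_into_subset.
have cmin : continuous ((cst 1 : R -> R^o) \min id).
  by move=> x; apply: continuous_min => //; exact: cst_continuous.
have : continuous ((cst 0 : R -> R^o) \max ((cst 1 : R -> R^o) \min id)).
  by move=> x; apply: continuous_max; [exact: cst_continuous|exact: cmin].
exact.
Qed.

Lemma continuous_time (A : topologicalType) :
  continuous (fun p : A * itvI R => set_val p.2 : R).
Proof.
exact: continuous_compose (@continuous_snd A _) (@continuous_set_val _ _).
Qed.

Lemma homotopic_sym (A B : topologicalType) (h k : A -> B) :
  homotopic R h k -> homotopic R k h.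
Proof.
move=> [H [cH H0 H1]].
have crev : continuous (fun p : A * itvI R => 1 - set_val p.2 : R).
  by move=> p; apply: cvgB; [exact: cvg_cst|exact: continuous_time].
exists (fun p => H (p.1, clamp (1 - set_val p.2))); split=> /=.
- apply: (continuous_comp_pair cH (@continuous_fst _ _)).
  exact: continuous_compose crev continuous_clamp.
- by move=> a; rewrite clamp_ge1 // subr0.
- by move=> a; rewrite clamp_le0 // subrr.
Qed.

(** Each half of the concatenation is given by a formula that is continuous for
    all times, thanks to [clamp], and the two formulas agree at time [1/2], so
    preimages of closed sets are unions of two closed sets. *)
Lemma homotopic_trans (A B : topologicalType) (h k l : A -> B) :
  homotopic R h k -> homotopic R k l -> homotopic R h l.
Proof.
move=> [H [cH H0 H1]] [K [cK K0 K1]].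
pose time (p : A * itvI R) : R := set_val p.2.
pose F p := H (p.1, clamp (2 * time p)).
pose G p := K (p.1, clamp (2 * time p - 1)).
have ctime : continuous time := @continuous_time A.
have c2time : continuous (fun p => 2 * time p).
  by move=> p; apply: cvgM; [exact: cvg_cst|exact: ctime].
have cF : continuous F.
  apply: (continuous_comp_pair cH (@continuous_fst _ _)).
  exact: continuous_compose c2time continuous_clamp.
have c2time1 : continuous (fun p => 2 * time p - 1).
  by move=> p; apply: cvgB; [exact: c2time|exact: cvg_cst].
have cG : continuous G.
  apply: (continuous_comp_pair cK (@continuous_fst _ _)).
  exact: continuous_compose c2time1 continuous_clamp.
exists (fun p => if time p <= 2^-1 then F p else G p); split.
- apply/continuous_closedP => C cC.
  have FG p : time p = 2^-1 -> F p = G p.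
    rewrite /F /G -/(time p) => ->.
    by rewrite clamp_ge1 ?clamp_le0 ?H1 ?K0 //; lra.
  rewrite (_ : _ @^-1` C = (F @^-1` C `&` [set p | time p <= 2^-1]) `|`
                           (G @^-1` C `&` [set p | 2^-1 <= time p])).
    apply: closedU; apply: closedI.
    + exact: (iffLR (continuous_closedP _) cF _ cC).
    + exact: (iffLR (continuous_closedP _) ctime _ (@closed_le _ _)).
    + exact: (iffLR (continuous_closedP _) cG _ cC).
    + exact: (iffLR (continuous_closedP _) ctime _ (@closed_ge _ _)).
  apply/seteqP; split=> p /=.
    by case: ifPn => [t12 FC|]; [left|rewrite -ltNge => /ltW t12 GC; right].
  case=> -[]; first by move=> FC ->.
  move=> GC t12; case: ifPn => // t21.
  by rewrite FG //; apply/eqP; rewrite eq_le t12 t21.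
- by move=> a; rewrite /time /= invr_ge0 ler0n /F /= mulr0 clamp_le0.
- move=> a; have half_lt1 : ((1 : R) <= 2^-1) = false.
    by apply/negbTE; rewrite -ltNge; lra.
  have t1 : time (a, I1 R) = 1 by [].
  by rewrite t1 half_lt1 /G t1 clamp_ge1 ?K1 //; lra.
Qed.

Lemma homotopic_comp_l (A B C : topologicalType) (h k : A -> B) (l : B -> C) :
  continuous l -> homotopic R h k -> homotopic R (l \o h) (l \o k).
Proof.
move=> cl [H [cH H0 H1]]; exists (l \o H); split.
- exact: continuous_compose cH cl.
- by move=> a /=; rewrite H0.
- by move=> a /=; rewrite H1.
Qed.

Lemma homotopic_comp_r (A B C : topologicalType) (l : A -> B) (h k : B -> C) :
  continuous l -> homotopic R h k -> homotopic R (h \o l) (k \o l).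
Proof.
move=> cl [H [cH H0 H1]]; exists (fun p => H (l p.1, p.2)); split.
- apply: (continuous_comp_pair cH) (@continuous_snd _ _).
  exact: continuous_compose (@continuous_fst _ _) cl.
- by move=> a /=; rewrite H0.
- by move=> a /=; rewrite H1.
Qed.

(** * Path-connectedness *)

Definition path_joined (B : topologicalType) (a b : B) : Prop :=
  exists gamma : itvI R -> B,
    [/\ continuous gamma, gamma (I0 R) = a & gamma (I1 R) = b].

Definition path_connected (B : topologicalType) : Prop :=
  forall a b : B, path_joined a b.

(** With [homotopic_path_joined], this makes paths the same thing as homotopies
    between constant maps, so that they inherit reversal and concatenation. *)
Lemma path_joined_homotopic_cst (A B : topologicalType) (a b : B) :
  path_joined a b -> homotopic R (cst a : A -> B) (cst b).
Proof.
move=> [gamma [cgamma g0 g1]]; exists (gamma \o snd); split=> //.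
exact: continuous_compose (@continuous_snd _ _) cgamma.
Qed.

Lemma homotopic_path_joined (A B : topologicalType) (h k : A -> B) (a : A) :
  homotopic R h k -> path_joined (h a) (k a).
Proof.
move=> [H [cH H0 H1]]; exists (fun t => H (a, t)); split=> //.
have ca : continuous (cst a : itvI R -> A) by exact: cst_continuous.
have cid : continuous (@id (itvI R)) by move=> t; exact: cvg_id.
exact: continuous_comp_pair cH ca cid.
Qed.

Lemma path_joined_refl (B : topologicalType) (a : B) : path_joined a a.
Proof. by exists (cst a); split=> //; exact: cst_continuous. Qed.

Lemma path_joined_sym (B : topologicalType) (a b : B) :
  path_joined a b -> path_joined b a.
Proof.
move=> /(@path_joined_homotopic_cst (itvI R) _ _ _)/homotopic_sym.
exact: homotopic_path_joined (I0 R).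
Qed.

Lemma path_joined_trans (B : topologicalType) (a b c : B) :
  path_joined a b -> path_joined b c -> path_joined a c.
Proof.
move=> /(@path_joined_homotopic_cst (itvI R) _ _ _) ab.
move=> /(@path_joined_homotopic_cst (itvI R) _ _ _) bc.
exact: homotopic_path_joined (I0 R) (homotopic_trans ab bc).
Qed.

Lemma path_joined_map (A B : topologicalType) (h : A -> B) (a b : A) :
  continuous h -> path_joined a b -> path_joined (h a) (h b).
Proof.
move=> ch [gamma [cgamma g0 g1]]; exists (h \o gamma); split=> /=.
- exact: continuous_compose cgamma ch.
- by rewrite g0.
- by rewrite g1.
Qed.

(** Two points of [A] are sent to [B], joined there, and the path is sent back;
    the homotopy [k \o h ~ id] joins each point to the corresponding end. *)
Lemma path_connected_homotopy_equivalent (A B : topologicalType) :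
  homotopy_equivalent R A B -> path_connected B -> path_connected A.
Proof.
move=> [h [k [ch ck kh hk]]] pB a b.
apply: path_joined_trans (homotopic_path_joined b kh).
apply: path_joined_trans (path_joined_map ck (pB (h a) (h b))).
exact: path_joined_sym (homotopic_path_joined a kh).
Qed.

Lemma sqnormZ n (c : R) (x : 'rV[R]_n) : sqnorm (c *: x) = c ^+ 2 * sqnorm x.
Proof. by rewrite /sqnorm mulr_sumr; apply: eq_bigr => i _; rewrite mxE exprMn. Qed.

Lemma disk_scale_subproof n (x : disk R n) (t : itvI R) :
  sqnorm (set_val t *: set_val x : 'rV[R]_n) <= 1.
Proof.
have /andP[t0 t1] := set_val_itv t.
rewrite sqnormZ mulr_ile1 ?exprn_ge0 ?exprn_ile1 //.
  by apply: sumr_ge0 => i _; rewrite sqr_ge0.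
exact: (set_valP x).
Qed.

Definition disk_scale n (x : disk R n) (t : itvI R) : disk R n :=
  exist _ (set_val t *: set_val x)
    (mem_set (disk_scale_subproof x t : [set y | sqnorm y <= 1] _)).

(** The disk is star-shaped about its centre. *)
Lemma disk_path_connected n : path_connected (disk R n).
Proof.
have joined0 (x y : disk R n) : path_joined (disk_scale y (I0 R)) x.
  (* [disk_scale y (I0 R)] is the centre of the disk, whatever [y] is. *)
  exists (disk_scale x); split=> /=.
  - apply: continuous_into_subset.
    have cscale : continuous (fun c : R => c *: (set_val x : 'rV[R]_n)).
      by move=> c; apply: cvgZr_tmp; exact: cvg_id.
    exact: continuous_compose (@continuous_set_val _ _) cscale.
  - by apply: val_inj; rewrite /= !scale0r.
  - by apply: val_inj; rewrite /= !scale1r.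
move=> x y; apply: path_joined_trans (joined0 y x).
exact/path_joined_sym/joined0.
Qed.

(** The image of a characteristic map is path-connected, so a set saturated for
    [path_joined] has preimage empty or full in each disk, and is therefore closed
    in the weak topology. Both a path component and its complement are
    saturated. *)
Lemma connected_CW_path_connected (W : topologicalType) :
  is_CW_complex R W -> connected [set: W] -> path_connected W.
Proof.
move=> [_ [J [d [phi [cphi _ _ _ weak]]]]] connW a.
pose C : set W := [set b | path_joined a b].
have saturated_closed (S : set W) :
    (forall b c, path_joined b c -> S b -> S c) -> closed S.
  move=> Ssat; apply: weak => j.
  have phi_joined x y : path_joined (phi j x) (phi j y).
    exact/path_joined_map/disk_path_connected.
  have [[x Sx]|noS] := pselect (exists x, S (phi j x)).
    rewrite (_ : _ @^-1` S = setT); first exact: closedT.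
    by apply/seteqP; split=> // y _; exact: Ssat (phi_joined x y) Sx.
  rewrite (_ : _ @^-1` S = set0); first exact: closed0.
  by apply/seteqP; split=> // x Sx; apply: noS; exists x.
have Csat b c : path_joined b c -> C b -> C c.
  by move=> bc ab; exact: path_joined_trans ab bc.
have CT : C = setT.
  apply: connW.
  - by exists a; exact: path_joined_refl.
  - exists C; last by rewrite setTI.
    rewrite -[C]setCK; apply: closed_openC; apply: saturated_closed => b c bc Cb Cc.
    by apply: Cb; apply: Csat Cc; exact: path_joined_sym.
  - exists C; last by rewrite setTI.
    exact: saturated_closed.
by move=> b; have : C b by rewrite CT.
Qed.

Lemma connected_CW_type_nonempty (X : topologicalType) :
  has_connected_CW_type R X -> [set: X] !=set0.
Proof. by move=> [W [_ [w _] _ [_ [k _]]]]; exists (k w). Qed.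

Lemma connected_CW_type_path_connected (X : topologicalType) :
  has_connected_CW_type R X -> path_connected X.
Proof.
move=> [W [cwW _ connW XW]].
exact: path_connected_homotopy_equivalent XW (connected_CW_path_connected cwW connW).
Qed.

(** * Mapping cylinder *)

Section Cylinder.
Variables (X Y : topologicalType) (f : X -> Y).

Definition cyl_base (y : Y) : mapping_cylinder R f :=
  \pi_(mapping_cylinder R f) (@cyl_bot R X Y y).

Lemma continuous_cyl_base : continuous cyl_base.
Proof.
apply: (@continuous_compose _ _ _ (@cyl_bot R X Y)).
  exact: (@existT_continuous _ (@cyl_piece R X Y) false).
exact: pi_continuous.
Qed.

(** The collapse of the cylinder onto its base is defined on the topological sum
    and descends to the quotient because it is unchanged by [cyl_glue]. *)
Definition cyl_piece_retraction (b : bool) : cyl_piece R X Y b -> Y :=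
  match b with true => fun xt => f xt.1 | false => fun y => y end.

Definition cyl_sum_retraction : cyl_sum R X Y -> Y :=
  fun p => @cyl_piece_retraction (tag p) (tagged p).

Definition cyl_retraction : mapping_cylinder R f -> Y :=
  cyl_sum_retraction \o repr.

Lemma cyl_sum_retraction_glue p :
  cyl_sum_retraction (cyl_glue f p) = cyl_sum_retraction p.
Proof. by case: p => -[[x t]|y] //=; case: ifP. Qed.

Lemma cyl_sum_retraction_pi p q :
  \pi_(mapping_cylinder R f) p = \pi_(mapping_cylinder R f) q ->
  cyl_sum_retraction p = cyl_sum_retraction q.
Proof.
move=> /eqmodP /eqP pq.
by rewrite -cyl_sum_retraction_glue pq cyl_sum_retraction_glue.
Qed.

Lemma cyl_retraction_pi p :
  cyl_retraction (\pi_(mapping_cylinder R f) p) = cyl_sum_retraction p.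
Proof. by apply: cyl_sum_retraction_pi; rewrite reprK. Qed.

Lemma continuous_cyl_retraction : continuous f -> continuous cyl_retraction.
Proof.
move=> cf; apply: repr_comp_continuous; last first.
  by move=> p q /eqP pq; apply/eqP; exact: cyl_sum_retraction_pi.
apply: sigT_continuous => -[/=|y]; last exact: cvg_id.
exact: continuous_compose (@continuous_fst _ _) cf.
Qed.

Lemma cyl_retraction_base y : cyl_retraction (cyl_base y) = y.
Proof. exact: cyl_retraction_pi. Qed.

Lemma cyl_retraction_incl x : cyl_retraction (cyl_incl R f x) = f x.
Proof. exact: cyl_retraction_pi. Qed.

End Cylinder.

Arguments cyl_retraction {X Y} f p.


(** * Section-categorical sets *)

Section SectionCategorical.
Variable E : topologicalType -> Prop.

(** If [A] can be deformed in [Z] so that it factors through [V], a factorization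
    of [V] through a space of the collection serves for [A]. *)
Lemma section_categorical_lift (X Y Z : topologicalType) (f : X -> Y)
    (g : Y -> Z) (V : set Y) (A : set Z) (s : A -> V) :
  continuous g -> continuous s ->
  homotopic R (g \o set_val \o s) (set_val : A -> Z) ->
  section_categorical R E f V -> section_categorical R E (g \o f) A.
Proof.
move=> cg cs gs [T [u [v [ET cu cv fvu]]]]; exists T, (u \o s), v; split=> //.
  exact: continuous_compose cs cu.
apply: homotopic_trans gs.
exact: homotopic_comp_r cs (homotopic_comp_l cg fvu).
Qed.

(** The contraction of [A] ends at [z], which may lie outside the image of [h]. A
    path from [z] to some [h x] corrects this, and constant maps factor through the
    one-point space, which belongs to every collection. *)
Lemma section_categorical_null (X Z : topologicalType) (h : X -> Z)
    (A : set Z) (z : Z) :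
  is_collection R E -> [set: X] !=set0 -> path_connected Z ->
  homotopic R (set_val : A -> Z) (cst z) -> section_categorical R E h A.
Proof.
move=> [_ [T ET [p _]]] [x _] pZ Az; exists T, (cst p), (cst x); split=> //.
- exact: cst_continuous.
- exact: cst_continuous.
- apply: homotopic_trans (homotopic_sym Az).
  exact: path_joined_homotopic_cst (pZ (h x) z).
Qed.

(** The deformation of [U_0] into [Y] and the contractions of the other [U_i] take
    place in the mapping cylinder; conjugating them by the inclusion of the base
    and the retraction onto it moves them to [Z], where [Y] enters through [g]. *)
Lemma FH_cover_secat_cover (X Y Z : topologicalType) (f : X -> Y) (g : Y -> Z)
    n m (U : 'I_n.+1 -> set (mapping_cylinder R g)) (V : 'I_m.+1 -> set Y) :
  is_collection R E -> [set: X] !=set0 -> path_connected Z -> continuous g ->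
  FH_cover R (@cyl_incl R Y Z g) U ->
  open_cover V -> (forall j, section_categorical R E f (V j)) ->
  exists W : 'I_(n + m).+1 -> set Z,
    open_cover W /\ forall i, section_categorical R E (g \o f) (W i).
Proof.
move=> hE X0 pZ cg [[oU UT] Unull _ [r [H [cr rH _]]]] [oV VT] Vsec.
have cbase := @continuous_cyl_base Y Z g.
have cret := continuous_cyl_retraction cg.
pose W0 j : set Z := cyl_base g @^-1` (set_val @` (r @^-1` V j)).
pose W1 i : set Z := cyl_base g @^-1` U i.
have oW0 j : open (W0 j).
  have orV := iffLR (continuousP _) cr _ (oV j).
  exact: (iffLR (continuousP _) cbase _ (open_image_set_val (oU ord0) orV)).
have oW1 i : open (W1 i) := iffLR (continuousP _) cbase _ (oU i).
have W0sec j : section_categorical R E (g \o f) (W0 j).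
  have W0U (w : W0 j) : U ord0 (cyl_base g (set_val w)).
    by have [p _ <-] := set_valP w; exact: set_valP.
  (* [b] embeds [W0 j] in [U_0], and [r \o b] sends it to [V j]. *)
  pose b := corestrict W0U.
  have cb : continuous b.
    apply: continuous_corestrict.
    exact: continuous_compose (@continuous_set_val _ _) cbase.
  have rbV (w : W0 j) : V j (r (b w)).
    have [p Vp pw] := set_valP w.
    by rewrite (_ : b w = p) //; apply: val_inj.
  apply: (@section_categorical_lift _ _ _ _ _ _ _ (corestrict rbV)) (Vsec j) => //.
    exact/continuous_corestrict/(continuous_compose cb cr).
  have ret_set_val : cyl_retraction g \o set_val \o b = set_val.
    by apply/funext => w /=; exact: cyl_retraction_base.
  have ret_incl :
      cyl_retraction g \o (cyl_incl R g \o r) \o b =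
      g \o set_val \o corestrict rbV.
    by apply/funext => w /=; exact: cyl_retraction_incl.
  rewrite -ret_incl -ret_set_val; apply: homotopic_sym.
  apply: (homotopic_comp_r cb); apply: (homotopic_comp_l cret).
  by exists H.
have W1sec i : i != ord0 -> section_categorical R E (g \o f) (W1 i).
  move=> /Unull [p Up].
  apply: (@section_categorical_null _ _ _ _ (cyl_retraction g p)) => //.
  pose b := @corestrict _ _ (U i) (fun w : W1 i => cyl_base g (set_val w))
              (fun w => set_valP w).
  have cb : continuous b.
    apply: continuous_corestrict.
    exact: continuous_compose (@continuous_set_val _ _) cbase.
  have ret_set_val : cyl_retraction g \o set_val \o b = set_val.
    by apply/funext => w /=; exact: cyl_retraction_base.
  rewrite -ret_set_val.
  exact: homotopic_comp_r cb (homotopic_comp_l cret Up).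
(* The indices [0, .., m] are those of the [V_j]; the index [m + i], for
   [0 < i <= n], is that of [U_i]. *)
exists (fun i => if (i <= m)%N then W0 (inord i) else W1 (inord (i - m))).
split; [split|].
- by move=> i; case: ifP.
- apply/seteqP; split=> // z _.
  have [i _ Ui] : (\bigcup_i U i) (cyl_base g z) by rewrite UT.
  have [i0|i0] := eqVneq i ord0.
    rewrite i0 in Ui.
    pose p : U ord0 := exist _ (cyl_base g z) (mem_set Ui).
    have [j _ Vj] : (\bigcup_j V j) (r p) by rewrite VT.
    have jm : (j <= m)%N by rewrite -ltnS.
    have jnm : (j < (n + m).+1)%N by rewrite ltnS (leq_trans jm) ?leq_addl.
    by exists (inord j) => //; rewrite inordK // jm inord_val; exists p.
  have i_gt0 : (0 < i)%N by rewrite lt0n.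
  have i_le : (i <= n)%N by rewrite -ltnS.
  exists (inord (i + m)) => //.
  rewrite inordK ?ltnS ?leq_add2r // leqNgt -{1}[m]add0n ltn_add2r i_gt0 /=.
  by rewrite addnK inord_val.
- move=> i; case: leqP => // mi; apply: W1sec.
  rewrite -val_eqE /= inordK ?subn_eq0 -?ltnNge //.
  by rewrite ltnS leq_subLR [(m + n)%N]addnC -ltnS.
Qed.

End SectionCategorical.

End HomotopyTheory.

(** * Numerical invariants *)

Lemma least_or_infty_le (P : nat -> Prop) n :
  P n -> (least_or_infty P <= (Posz n)%:E)%E.
Proof.
move=> Pn; rewrite /least_or_infty; case: pselect => [exP|noP].
  by case: ex_minnP => k _ kmin; rewrite lee_fin lez_nat; exact/kmin/asboolP.
by exfalso; apply: noP; exists n; exact/asboolP.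
Qed.

Lemma least_or_infty_attained (P : nat -> Prop) :
  least_or_infty P = +oo%E \/
  exists2 n, P n & least_or_infty P = (Posz n)%:E.
Proof.
rewrite /least_or_infty; case: pselect => [exP|]; last by left.
by right; case: ex_minnP => n /asboolP Pn _; exists n.
Qed.

Theorem theorem5p4 (R : realType) (E : topologicalType -> Prop)
  (X Y Z : topologicalType) (f : X -> Y) (g : Y -> Z)
  (hE : is_collection R E)
  (hX : has_connected_CW_type R X)
  (hY : has_connected_CW_type R Y)
  (hZ : has_connected_CW_type R Z)
  (hf : continuous f) (hg : continuous g) :
  (secat R E (g \o f) <= catFH R g + secat R E f)%E.
Proof.
rewrite {2}/secat /catFH.
have [->|[m [V [oV Vsec]] ->]] :=
  least_or_infty_attained (fun m => exists V : 'I_m.+1 -> set Y,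
    open_cover V /\ forall i, section_categorical R E f (V i)).
  by case: (least_or_infty_attained (fun n =>
       exists U : 'I_n.+1 -> set (mapping_cylinder R g),
         FH_cover R (@cyl_incl R Y Z g) U)) => [->|[n _ ->]]; exact: leey.
have [->|[n [U FH] ->]] := least_or_infty_attained (fun n =>
  exists U : 'I_n.+1 -> set (mapping_cylinder R g),
    FH_cover R (@cyl_incl R Y Z g) U); first exact: leey.
rewrite -EFinD -PoszD; apply: least_or_infty_le.
exact: FH_cover_secat_cover hE (connected_CW_type_nonempty hX)
  (connected_CW_type_path_connected hZ) hg FH oV Vsec.
Qed.
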